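(* Let $H$ and $K$ be finite Abelian groups, let $\psi: K \to \operatorname{Aut}(H)$ be a group homomorphism, and let $H \rtimes_{\psi} K$ be the corresponding semidirect product. Then every supercharacter theory of $H\rtimes_\psi K$ is isomorphic to a supercharacter theory of the direct product $H\times K$. Moreover, there is a supercharacter theory $A$ of $H\times K$, isomorphic to the minimal supercharacter theory of $H\rtimes_\psi K$, such that there is a bijection between the supercharacter theories of $H\rtimes_\psi K$ and the supercharacter theories of $H\times K$ that are coarser than or equal to $A$. In particular, the lattice of supercharacter theories of $H\rtimes_\psi K$ is (isomorphic to) a sublattice of the lattice of supercharacter theories of $H\times K$.
   Context: For a finite group $G$ with identity $e$, let $*$ denote the usual product on the group algebra $\mathbb{C}G$, and let $\circ$ denote the Hadamard product, $\left(\sum_{g\in G} a_g g\right)\circ\left(\sum_{g\in G} b_g g\right)=\sum_{g\in G}(a_g b_g) g$. A supercharacter theory for $G$ is a pair $(\mathcal{X},\mathcal{K})$, where $\mathcal{X}$ is a partition of the set $\operatorname{Irr}(G)$ of irreducible complex characters and $\mathcal{K}$ is a partition of the set of conjugacy classes of $G$ (each part being identified with the union of its classes, a subset of $G$), such that $\{e\}\in\mathcal{K}$, the singleton of the trivial character is in $\mathcal{X}$, $|\mathcal{X}|=|\mathcal{K}|$, and for each $X\in\mathcal{X}$ the function $\sigma_X=\sum_{\chi\in X}\chi(e)\chi$ is constant on each member of $\mathcal{K}$. Supercharacter theories of $G$ are in bijective correspondence with (and are identified with) the $\mathbb{C}$-linear subspaces $A$ of the center $Z(\mathbb{C}G)$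 that contain $e$ and $\sum_{g\in G} g$ and are closed under both $*$ and $\circ$; the subspace corresponding to $(\mathcal{X},\mathcal{K})$ has basis $\{\widehat{L}: L\in\mathcal{K}\}$, where $\widehat{L}=\sum_{g\in L} g$. The set of supercharacter theories of $G$ forms a lattice under the partial order given by refinement of the partitions $\mathcal{K}$ of $G$ (equivalently, of the partitions $\mathcal{X}$ of $\operatorname{Irr}(G)$), finer theories being smaller. The minimal supercharacter theory of $G$ is the one in which each conjugacy class is a part of $\mathcal{K}$ and $\mathcal{X}$ consists of singletons; the corresponding algebra is $Z(\mathbb{C}G)$. A theory is coarser than or equal to $A$ if its partitions are coarser than or equal to those of $A$. A homomorphism of supercharacter theories $\phi:A\to B$ (with $A$ a supercharacter theory for a finite group $G_1$ and $B$ one for a finite group $G_2$, both viewed as algebras) is a $\mathbb{C}$-linear map with $\phi(x*y)=\phi(x)*\phi(y)$ and $\phi(x\circ y)=\phi(x)\circ\phi(y)$ for all $x,y\in A$; an isomorphism is a bijective homomorphism. The semidirect product $H\rtimes_\psi K$ has underlying set $H\times K$ and multiplication $(h_1,k_1)(h_2,k_2)=(h_1\psi(k_1)(h_2),k_1k_2)$. *)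

(* Defs.v *)
From HB Require Import structures.
From mathcomp Require Import all_boot all_order all_algebra.
From mathcomp Require Import all_fingroup all_solvable all_field all_character.

Set Implicit Arguments.
Unset Strict Implicit.
Unset Printing Implicit Defensive.

Import Order.TTheory GRing.Theory Num.Theory GroupScope.
Local Open Scope ring_scope.

(* A homomorphism psi : K -> Aut(H). The product of {perm hT} is composition  *)
(* in the reverse order, so multiplicativity is stated pointwise.             *)
Record autHom (hT kT : finGroupType) := AutHom {
  autHom_fun :> kT -> {perm hT};
  autHom_Aut : forall k, autHom_fun k \in Aut [set: hT];
  autHomM : forall k1 k2 h,
    autHom_fun (k1 * k2)%g h = autHom_fun k1 (autHom_fun k2 h)
}.

(* The library's sdprod_by uses right actions and the order (k, h).           *)
Record semidirect (hT kT : finGroupType) (psi : autHom hT kT) : predArgType :=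
  SemiDirect { sd_pair : hT * kT }.

Section SemidirectGroup.
Variables (hT kT : finGroupType) (psi : autHom hT kT).
Local Notation sd := (semidirect psi).
Implicit Types u v : sd.

HB.instance Definition _ := [isNew for @sd_pair hT kT psi].
#[hnf] HB.instance Definition _ := [Finite of sd by <:].

Definition sd_one : sd := SemiDirect psi (1%g, 1%g).
Definition sd_mul u v : sd :=
  let: (h1, k1) := sd_pair u in let: (h2, k2) := sd_pair v in
  SemiDirect psi ((h1 * psi k1 h2)%g, (k1 * k2)%g).
Definition sd_inv u : sd :=
  let: (h, k) := sd_pair u in SemiDirect psi (psi k^-1%g h^-1%g, k^-1%g).

Lemma autHomJ k : {morph psi k : x y / (x * y)%g}.
Proof.
by move=> x y; rewrite -!(autmE (autHom_Aut psi k)) morphM ?inE.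
Qed.

Lemma autHom1 h : psi 1%g h = h.
Proof. by apply: (@perm_inj _ (psi 1%g)); rewrite -autHomM mulg1. Qed.

Fact sd_mulA : associative sd_mul.
Proof.
move=> [[h1 k1]] [[h2 k2]] [[h3 k3]]; congr (SemiDirect _ (_, _)) => /=.
  by rewrite autHomJ autHomM mulgA.
by rewrite mulgA.
Qed.

Fact sd_mul1 : left_id sd_one sd_mul.
Proof. by move=> [[h k]]; rewrite /sd_mul /= autHom1 !mul1g. Qed.

Fact sd_mulV : left_inverse sd_one sd_inv sd_mul.
Proof.
move=> [[h k]]; rewrite /sd_mul /= -autHomJ !mulVg; congr (SemiDirect _ (_, _)).
by apply: (mulgI (psi k^-1%g 1%g)); rewrite -autHomJ !mulg1.
Qed.

HB.instance Definition _ := Finite_isGroup.Build sd sd_mulA sd_mul1 sd_mulV.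

End SemidirectGroup.

Section Partitions.
Variable I : finType.
Implicit Types P Q R : {set {set I}}.

Definition refines P Q := [forall B in P, [exists C in Q, B \subset C]].

Lemma refinesP P Q :
  reflect (forall B, B \in P -> exists2 C, C \in Q & B \subset C) (refines P Q).
Proof.
apply: (iffP forall_inP) => PQ B /PQ => [/exists_inP | BQ]; first by [].
exact/exists_inP.
Qed.

Lemma refines_refl P : refines P P.
Proof. by apply/refinesP=> B PB; exists B. Qed.

Lemma refines_trans Q P R : refines P Q -> refines Q R -> refines P R.
Proof.
move=> /refinesP PQ /refinesP QR; apply/refinesP=> B /PQ[C /QR[D RD CD] BC].
by exists D => //; apply: subset_trans CD.
Qed.

Lemma refines_anti P Q :
  partition P [set: I] -> partition Q [set: I] ->
  refines P Q -> refines Q P -> P = Q.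
Proof.
have sub P1 Q1 : partition P1 [set: I] -> refines P1 Q1 -> refines Q1 P1 ->
    P1 \subset Q1.
  case/and3P=> _ trP nP0 /refinesP PQ /refinesP QP; apply/subsetP=> B PB.
  have [C QC sBC] := PQ B PB; have [D PD sCD] := QP C QC.
  suff eqBD: B = D by rewrite (_ : B = C) //; apply/eqP; rewrite eqEsubset sBC eqBD.
  have [x Bx] : exists x, x \in B.
    by apply/set0Pn; apply: contraNneq nP0 => <-.
  have Dx := subsetP sCD x (subsetP sBC x Bx).
  by rewrite -(def_pblock trP PB Bx) (def_pblock trP PD Dx).
move=> pP pQ PQ QP; apply/eqP; rewrite eqEsubset !sub //.
Qed.

Definition same_block P i j := pblock P i == pblock P j.

Definition pjoin_rel P Q : rel I :=
  connect [rel i j | same_block P i j || same_block Q i j].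

(* The finest partition of I that is coarser than both P and Q.               *)
Definition pjoin P Q := equivalence_partition (pjoin_rel P Q) [set: I].

Lemma pjoin_equiv P Q : {in [set: I] & &, equivalence_rel (pjoin_rel P Q)}.
Proof.
have symr : symmetric [rel i j | same_block P i j || same_block Q i j].
  by move=> i j; rewrite /= /same_block eq_sym [pblock Q i == _]eq_sym.
move=> i j k _ _ _; split; first exact: connect0.
by move=> con; apply: (same_connect (sym_connect_sym symr) con).
Qed.

Lemma pjoin_partition P Q : partition (pjoin P Q) [set: I].
Proof. exact: equivalence_partitionP (pjoin_equiv P Q). Qed.

Lemma mem_pjoin P Q B i j : B \in pjoin P Q -> i \in B ->
  (j \in B) = pjoin_rel P Q i j.
Proof.
have /and3P[_ tr _] := pjoin_partition P Q.
move=> PB Bi; rewrite -(def_pblock tr PB Bi).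
exact: (pblock_equivalence_partition (pjoin_equiv P Q)) (in_setT i) (in_setT j).
Qed.

Lemma pjoinC P Q : pjoin P Q = pjoin Q P.
Proof.
have e : pjoin_rel P Q =2 pjoin_rel Q P.
  by apply: eq_connect => i j /=; rewrite orbC.
rewrite /pjoin /equivalence_partition; apply: eq_imset => i.
by apply/setP=> j; rewrite !inE e.
Qed.

Lemma same_blockE P B i j : partition P [set: I] -> B \in P -> i \in B ->
  same_block P i j = (j \in B).
Proof.
case/and3P=> /eqP covP trP _ PB Bi.
rewrite /same_block (eq_pblock _ trP) ?covP //.
by rewrite (def_pblock trP PB Bi).
Qed.

Lemma refines_pjoinl P Q : partition P [set: I] -> refines P (pjoin P Q).
Proof.
move=> pP; apply/refinesP=> B PB.
have [i Bi] : exists i, i \in B.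
  by case/and3P: pP => _ _ nP0; apply/set0Pn; apply: contraNneq nP0 => <-.
have /and3P[/eqP covJ _ _] := pjoin_partition P Q.
have Ji : i \in cover (pjoin P Q) by rewrite covJ.
exists (pblock (pjoin P Q) i); first exact: pblock_mem.
apply/subsetP=> j Bj.
rewrite (@mem_pjoin P Q _ i) ?pblock_mem ?mem_pblock //.
by apply: connect1; rewrite /= (same_blockE _ pP PB Bi) Bj.
Qed.

Lemma const_pjoin (T : eqType) P Q (f : I -> T) B :
  partition P [set: I] -> partition Q [set: I] -> B \in pjoin P Q ->
  (forall C, C \in P -> {in C &, forall i j, f i = f j}) ->
  (forall C, C \in Q -> {in C &, forall i j, f i = f j}) ->
  {in B &, forall i j, f i = f j}.
Proof.
move=> pP pQ PB fP fQ i j Bi; rewrite (mem_pjoin _ PB Bi) => con.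
have blk R : partition R [set: I] ->
    (forall C, C \in R -> {in C &, forall i j, f i = f j}) ->
    forall a b, same_block R a b -> f a = f b.
  move=> pR fR a b sab; have /and3P[/eqP covR _ _] := pR.
  have Ra : a \in cover R by rewrite covR.
  apply: (fR _ (pblock_mem Ra)); first by rewrite mem_pblock.
  by rewrite -(@same_blockE R _ a) ?pblock_mem ?mem_pblock.
have cl : closed [rel i j | same_block P i j || same_block Q i j]
                 [pred k | f k == f i].
  by move=> a b /= /orP[/(blk P pP fP)|/(blk Q pQ fQ)] ab; rewrite !inE ab.
by have := closed_connect cl con; rewrite !inE eqxx => /esym/eqP.
Qed.

Lemma pjoin_refines P Q R :
  partition P [set: I] -> partition Q [set: I] -> partition R [set: I] ->
  refines P R -> refines Q R -> refines (pjoin P Q) R.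
Proof.
move=> pP pQ pR /refinesP PR /refinesP QR; apply/refinesP=> B JB.
have /and3P[/eqP covR trR _] := pR.
have [i Bi] : exists i, i \in B.
  have /and3P[_ _ nJ0] := pjoin_partition P Q.
  by apply/set0Pn; apply: contraNneq nJ0 => <-.
have Ri : i \in cover R by rewrite covR.
exists (pblock R i); first exact: pblock_mem.
have blk (S : {set {set I}}) : (forall C, C \in S -> exists2 D, D \in R & C \subset D) ->
    forall C, C \in S -> {in C &, forall a b, pblock R a = pblock R b}.
  move=> SR C /SR[D RD sCD] a b Ca Cb.
  by rewrite !(def_pblock trR RD) // (subsetP sCD).
apply/subsetP=> j Bj; rewrite (const_pjoin pP pQ JB (blk P PR) (blk Q QR) Bi Bj).
by rewrite mem_pblock covR.
Qed.

Lemma const_refines (T : Type) P Q (f : I -> T) : refines P Q ->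
  (forall C, C \in Q -> {in C &, forall i j, f i = f j}) ->
  (forall B, B \in P -> {in B &, forall i j, f i = f j}).
Proof.
move=> /refinesP PQ fQ B /PQ[C QC sBC] i j Bi Bj.
by apply: (fQ C); rewrite ?(subsetP sBC).
Qed.

Lemma pjoin_set1 P Q i : partition P [set: I] -> partition Q [set: I] ->
  [set i] \in P -> [set i] \in Q -> [set i] \in pjoin P Q.
Proof.
move=> pP pQ Pi Qi; have /and3P[/eqP covJ _ _] := pjoin_partition P Q.
have Ji : i \in cover (pjoin P Q) by rewrite covJ.
suff <- : pblock (pjoin P Q) i = [set i] by apply: pblock_mem.
apply/eqP; rewrite eqEsubset sub1set mem_pblock Ji andbT.
apply/subsetP=> j Jj.
have blk R : partition R [set: I] -> [set i] \in R ->
    forall C, C \in R -> {in C &, forall a b, (a == i) = (b == i)}.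
  move=> pR Ri C RC a b Ca Cb.
  have /and3P[_ trR _] := pR.
  have [e | n] := eqVneq C [set i].
    by move: Ca Cb; rewrite e !inE => -> ->.
  have := trivIsetP trR _ _ RC Ri n; rewrite disjoint_sym disjoints1 => iC.
  have ne c : c \in C -> (c == i) = false by apply: contraTF => /eqP->.
  by rewrite !ne.
have Ji' : i \in pblock (pjoin P Q) i by rewrite mem_pblock.
have := const_pjoin pP pQ (pblock_mem Ji) (blk P pP Pi) (blk Q pQ Qi) Ji' Jj.
by rewrite eqxx inE => <-.
Qed.

Section BlockSpan.
Variables (F : fieldType) (vT : vectType F) (l : I -> {linear vT -> F^o}).
Hypothesis l_inj : forall f, (forall i, l i f = 0) -> f = 0.

Definition block_span P (v : {set I} -> vT) := (\sum_(B in P) <[v B]>)%VS.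

Variables (P : {set {set I}}) (v : {set I} -> vT).
Hypothesis pP : partition P [set: I].
Hypothesis lv : forall B i, B \in P -> l i (v B) = (i \in B)%:R.

Let sum_lv (c : {set I} -> F) B i : B \in P -> i \in B ->
  l i (\sum_(A in P) c A *: v A) = c B.
Proof.
move=> PB Bi; have /and3P[_ trP _] := pP.
rewrite linear_sum (bigD1 B) //= linearZ /= lv // Bi [_ *: _]mulr1.
rewrite big1 ?addr0 // => A /andP[PA nAB]; rewrite linearZ /= lv //.
have := trivIsetP trP _ _ PA PB nAB.
by rewrite disjoint_sym => /disjointFr-> //; rewrite scaler0.
Qed.

Let block_ex B : B \in P -> exists i, i \in B.
Proof.
by case/and3P: pP => _ _ nP0 PB; apply/set0Pn; apply: contraNneq nP0 => <-.
Qed.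

Let repr_ex i : exists2 B, B \in P & i \in B.
Proof.
have /and3P[/eqP covP _ _] := pP.
by have : i \in cover P; [rewrite covP | case/bigcupP=> B; exists B].
Qed.

Let line_coef (u : {set I} -> vT) :
  (forall B, B \in P -> u B \in <[v B]>%VS) ->
  exists c : {set I} -> F, forall B, B \in P -> u B = c B *: v B.
Proof.
move=> uv; exists (fun B : {set I} =>
  if [pick i in B] is Some i then l i (u B) else 0).
move=> B PB; have /vlineP[a ua] := uv B PB; have [j Bj] := block_ex PB.
case: pickP => [i Bi | /(_ j)]; last by rewrite Bj.
by rewrite ua linearZ /= lv // Bi [_ *: 1]mulr1.
Qed.

Lemma block_spanP f :
  reflect (forall B, B \in P -> {in B &, forall i j, l i f = l j f})
          (f \in block_span P v).
Proof.
apply: (iffP idP) => [/memv_sumP[u uv ->] B PB i j Bi Bj | const].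
  have [c uE] := line_coef uv.
  by rewrite (eq_bigr _ uE) !(sum_lv c PB).
pose c (B : {set I}) := if [pick i in B] is Some i then l i f else 0.
have -> : f = \sum_(B in P) c B *: v B.
  apply/eqP; rewrite -subr_eq0; apply/eqP/l_inj => i.
  have [B PB Bi] := repr_ex i.
  rewrite linearB /= (sum_lv c PB Bi) /c.
  case: pickP => [j Bj | /(_ i)]; last by rewrite Bi.
  by rewrite (const B PB i j) // subrr.
by apply: memv_sumr => B PB; rewrite memvZ ?memv_line.
Qed.

Lemma dim_block_span : \dim (block_span P v) = #|P|.
Proof.
have /directvP/= -> : directv (\sum_(B in P) <[v B]>)%VS.
  apply/directv_sum_independent => u uv su0 B PB.
  have [c uE] := line_coef uv.
  have [i Bi] := block_ex PB.
  by rewrite uE // -(sum_lv c PB Bi) -(eq_bigr _ uE) su0 linear0 scale0r.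
rewrite -sum1_card; apply: eq_bigr => B PB; rewrite dim_vline.
have [i Bi] := block_ex PB.
suff -> : v B != 0 by [].
by apply: contra_eq_neq (lv i PB) => ->; rewrite linear0 Bi eq_sym oner_eq0.
Qed.

End BlockSpan.
End Partitions.

Section SuperTheory.
Variable gT : finGroupType.
Local Notation G := [set: gT].
Implicit Types (X : {set Iirr G}) (L : {set gT}).

Definition superchar X : 'CF(G) := \sum_(i in X) 'chi_i 1%g *: 'chi_i.

(* The parts of K are unions of conjugacy classes, viewed as subsets of gT.   *)
Definition is_super_theory (XK : {set {set Iirr G}} * {set {set gT}}) :=
  let: (Xs, Ks) := XK in
  [&& partition Xs [set: Iirr G],
      partition Ks G,
      [forall L in Ks, [forall x in L, x ^: G \subset L]],
      [set 1%g] \in Ks,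
      [set 0] \in Xs,
      #|Xs| == #|Ks| &
      [forall X in Xs, [forall L in Ks, [forall x in L, [forall y in L,
        superchar X x == superchar X y]]]]].

Record superTheory : predArgType := SuperTheory {
  super_pair : {set {set Iirr G}} * {set {set gT}};
  super_pairP : is_super_theory super_pair
}.

HB.instance Definition _ := [isSub for super_pair].
#[hnf] HB.instance Definition _ := [Finite of superTheory by <:].

Implicit Types S T U : superTheory.

Definition superXs S := (super_pair S).1.
Definition superKs S := (super_pair S).2.

Lemma is_super_theoryP Xs Ks :
  reflect [/\ partition Xs [set: Iirr G], partition Ks G,
              forall L x g, L \in Ks -> x \in L -> (x ^ g)%g \in L,
              [/\ [set 1%g] \in Ks, [set 0] \in Xs & #|Xs| = #|Ks|] &
              forall X L, X \in Xs -> L \in Ks ->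
                {in L &, forall x y, superchar X x = superchar X y}]
          (is_super_theory (Xs, Ks)).
Proof.
apply: (iffP and5P) => [[pX pK cK K1 /and3P[X0 /eqP cd sc]] |
                        [pX pK cK [K1 X0 cd] sc]]; split=> //.
- move=> L x g KL Lx; have /forall_inP/(_ x Lx)/subsetP := forall_inP cK L KL.
  by apply; rewrite memJ_class ?inE.
- move=> X L XX KL x y Lx Ly; apply/eqP.
  have /forall_inP/(_ L KL)/forall_inP/(_ x Lx) := forall_inP sc X XX.
  by move/forall_inP; apply.
- apply/forall_inP=> L KL; apply/forall_inP=> x Lx.
  by apply/subsetP=> _ /imsetP[g _ ->]; apply: cK.
- rewrite X0 cd eqxx; apply/forall_inP=> X XX; apply/forall_inP=> L KL.
  by apply/forall_inP=> x Lx; apply/forall_inP=> y Ly; apply/eqP/(sc X L).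
Qed.

Lemma super_theoryP S : is_super_theory (superXs S, superKs S).
Proof. by case: S => [[Xs Ks] ST]. Qed.

(* Class functions, evaluated at group elements or at irreducible characters  *)
(* (normalised so that superchar X takes the values 0 and 1).                 *)
Definition cf_at (x : gT) (f : 'CF(G)) : algC^o := f x.
Definition cf_coef (i : Iirr G) (f : 'CF(G)) : algC^o :=
  '[f, 'chi_i] / 'chi_i 1%g.

Fact cf_at_linear x : linear (cf_at x).
Proof. by move=> a f g; rewrite /cf_at !cfunE. Qed.
HB.instance Definition _ x :=
  GRing.isLinear.Build algC 'CF(G) algC^o *:%R (cf_at x) (cf_at_linear x).

Fact cf_coef_linear i : linear (cf_coef i).
Proof.
by move=> a f g; rewrite /cf_coef cfdotDl cfdotZl mulrDl -mulrA.
Qed.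
HB.instance Definition _ i :=
  GRing.isLinear.Build algC 'CF(G) algC^o *:%R (cf_coef i) (cf_coef_linear i).

Lemma cf_at_inj f : (forall x, cf_at x f = 0) -> f = 0.
Proof. by move=> f0; apply/cfunP=> x; rewrite cfunE; apply: f0. Qed.

Lemma cf_coef_inj f : (forall i, cf_coef i f = 0) -> f = 0.
Proof.
move=> f0; rewrite [f]cfun_sum_cfdot big1 // => i _.
have /eqP := f0 i; rewrite /cf_coef mulf_eq0 invr_eq0 (negPf (irr1_neq0 i)) orbF.
by move/eqP->; rewrite scale0r.
Qed.

Lemma cf_coef_superchar X i : cf_coef i (superchar X) = (i \in X)%:R.
Proof.
rewrite /cf_coef cfdot_suml; have [Xi | nXi] := boolP (i \in X).
  rewrite (bigD1 i) //= cfdotZl cfdot_irr eqxx big1 ?addr0 => [|j /andP[_ nji]].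
    by rewrite mulr1 divff ?irr1_neq0.
  by rewrite cfdotZl cfdot_irr (negPf nji) mulr0.
rewrite big1 ?mul0r // => j Xj.
rewrite cfdotZl cfdot_irr (negPf (_ : j != i)) ?mulr0 //.
by apply: contraNneq nXi => <-.
Qed.

Lemma cf_at_cfuni L x : (forall y g, y \in L -> (y ^ g)%g \in L) ->
  cf_at x '1_L = (x \in L)%:R.
Proof.
move=> cL; rewrite /cf_at cfuniE ?inE //.
rewrite /normal subsetT; apply/subsetP=> g _; rewrite inE.
by apply/subsetP=> _ /imsetP[y Ly ->]; apply: cL.
Qed.

Definition Xspace Xs := block_span Xs superchar.
Definition Kspace Ks := block_span Ks (fun L : {set gT} => '1_L : 'CF(G)).

Section Duality.
Variable S : superTheory.

Lemma superXs_partition : partition (superXs S) [set: Iirr G].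
Proof. by case/is_super_theoryP: (super_theoryP S). Qed.

Lemma superKs_partition : partition (superKs S) G.
Proof. by case/is_super_theoryP: (super_theoryP S). Qed.

Lemma superKsJ L x g : L \in superKs S -> x \in L -> (x ^ g)%g \in L.
Proof. by case/is_super_theoryP: (super_theoryP S) => _ _ cK _ _; apply: cK. Qed.

Lemma superKs1 : [set 1%g] \in superKs S.
Proof. by case/is_super_theoryP: (super_theoryP S) => _ _ _ []. Qed.

Lemma superXs0 : [set 0] \in superXs S.
Proof. by case/is_super_theoryP: (super_theoryP S) => _ _ _ []. Qed.

Lemma card_superXs : #|superXs S| = #|superKs S|.
Proof. by case/is_super_theoryP: (super_theoryP S) => _ _ _ []. Qed.

Lemma superchar_const X L : X \in superXs S -> L \in superKs S ->
  {in L &, forall x y, superchar X x = superchar X y}.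
Proof. by case/is_super_theoryP: (super_theoryP S) => _ _ _ _; apply. Qed.

Lemma super_cfuni L x : L \in superKs S -> cf_at x '1_L = (x \in L)%:R.
Proof. by move=> KL; apply: cf_at_cfuni => y g; apply: superKsJ. Qed.

Lemma XspaceP f :
  reflect (forall X, X \in superXs S ->
             {in X &, forall i j, cf_coef i f = cf_coef j f})
          (f \in Xspace (superXs S)).
Proof.
apply: (block_spanP cf_coef_inj superXs_partition) => X i _.
exact: cf_coef_superchar.
Qed.

Lemma KspaceP (f : 'CF(G)) :
  reflect (forall L, L \in superKs S -> {in L &, forall x y, f x = f y})
          (f \in Kspace (superKs S)).
Proof.
apply: (block_spanP cf_at_inj superKs_partition) => L x.
exact: super_cfuni.
Qed.

Lemma XspaceE : Xspace (superXs S) = Kspace (superKs S).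
Proof.
apply/eqP; rewrite eqEdim; apply/andP; split.
  apply/subv_sumP=> X XX; rewrite -memvE; apply/KspaceP=> L KL.
  exact: superchar_const.
have dX := dim_block_span superXs_partition (fun X i _ => cf_coef_superchar X i).
have dK := dim_block_span superKs_partition (fun L x => @super_cfuni L x).
by rewrite /Xspace /Kspace dX dK card_superXs.
Qed.

End Duality.

Lemma Kspace_refines S T : refines (superKs S) (superKs T) ->
  (Kspace (superKs T) <= Kspace (superKs S))%VS.
Proof.
move=> /refinesP ST; apply/subvP=> f /KspaceP fT; apply/KspaceP=> L /ST[M TM LM].
by move=> x y Lx Ly; apply: (fT M) => //; apply: (subsetP LM).
Qed.

Lemma refines_Xs S T :
  refines (superKs S) (superKs T) -> refines (superXs S) (superXs T).
Proof.
move/Kspace_refines; rewrite -!XspaceE => sTS; apply/refinesP=> X SX.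
have /and3P[/eqP covT _ _] := superXs_partition T.
have [i Xi] : exists i, i \in X.
  have /and3P[_ _ nS0] := superXs_partition S.
  by apply/set0Pn; apply: contraNneq nS0 => <-.
have Ti : i \in cover (superXs T) by rewrite covT.
exists (pblock (superXs T) i); first exact: pblock_mem.
apply/subsetP=> j Xj.
have /subvP/(_ (superchar (pblock (superXs T) i))) := sTS.
have -> : superchar (pblock (superXs T) i) \in Xspace (superXs T).
  rewrite memvE; apply: (sumv_sup (pblock (superXs T) i)) => //.
  exact: pblock_mem.
move/(_ isT)/XspaceP/(_ X SX i j Xi Xj)/eqP; rewrite !cf_coef_superchar.
by rewrite mem_pblock Ti eqr_nat; case: (j \in _).
Qed.

Definition super_le S T := refines (superKs S) (superKs T).

Fact super_le_refl : reflexive super_le.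
Proof. by move=> S; apply: refines_refl. Qed.

Fact super_le_anti : antisymmetric super_le.
Proof.
move=> S T /andP[ST TS]; apply: val_inj => /=.
rewrite [super_pair S]surjective_pairing [super_pair T]surjective_pairing.
congr (_, _); apply: refines_anti => //;
  by [apply: superXs_partition | apply: superKs_partition | apply: refines_Xs].
Qed.

Fact super_le_trans : transitive super_le.
Proof. by move=> T S U; apply: refines_trans. Qed.

Definition join_pair S T :=
  (pjoin (superXs S) (superXs T), pjoin (superKs S) (superKs T)).

Fact join_pairP S T : is_super_theory (join_pair S T).
Proof.
have pXS := superXs_partition S; have pXT := superXs_partition T.
have pKS := superKs_partition S; have pKT := superKs_partition T.
have pX := pjoin_partition (superXs S) (superXs T).
have pK := pjoin_partition (superKs S) (superKs T).
have cK L x g : L \in pjoin (superKs S) (superKs T) -> x \in L ->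
    (x ^ g)%g \in L.
  move=> KL Lx; rewrite (mem_pjoin _ KL Lx); apply: connect1 => /=.
  have /and3P[/eqP covS _ _] := pKS.
  have Sx : x \in cover (superKs S) by rewrite covS.
  rewrite (@same_blockE _ _ (pblock (superKs S) x)) ?pblock_mem //;
    rewrite ?mem_pblock //.
  by rewrite (superKsJ g (pblock_mem Sx)) ?mem_pblock.
have XP X i (_ : X \in pjoin (superXs S) (superXs T)) := cf_coef_superchar X i.
have KP L x (KL : L \in pjoin (superKs S) (superKs T)) : cf_at x '1_L = (x \in L)%:R.
  by apply: cf_at_cfuni => y g; apply: cK.
have leSX := refines_pjoinl (superXs T) pXS.
have leTX := refines_pjoinl (superXs S) pXT; rewrite pjoinC in leTX.
have leSK := refines_pjoinl (superKs T) pKS.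
have leTK := refines_pjoinl (superKs S) pKT; rewrite pjoinC in leTK.
have XtoK (f : 'CF(G)) : f \in Xspace (pjoin (superXs S) (superXs T)) ->
    forall L, L \in pjoin (superKs S) (superKs T) ->
    {in L &, forall x y, f x = f y}.
  move/(block_spanP cf_coef_inj pX XP) => fX L KL.
  have /KspaceP fS : f \in Kspace (superKs S).
    by rewrite -XspaceE; apply/XspaceP; apply: const_refines leSX fX.
  have /KspaceP fT : f \in Kspace (superKs T).
    by rewrite -XspaceE; apply/XspaceP; apply: const_refines leTX fX.
  exact: (const_pjoin pKS pKT KL fS fT).
have eqV : Xspace (pjoin (superXs S) (superXs T))
         = Kspace (pjoin (superKs S) (superKs T)).
  apply/vspaceP=> f; apply/idP/(block_spanP cf_at_inj pK KP) => [/XtoK // | fK].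
  apply/(block_spanP cf_coef_inj pX XP) => X XX.
  have /XspaceP fS : f \in Xspace (superXs S).
    by rewrite XspaceE; apply/KspaceP; apply: const_refines leSK fK.
  have /XspaceP fT : f \in Xspace (superXs T).
    by rewrite XspaceE; apply/KspaceP; apply: const_refines leTK fK.
  exact: (const_pjoin (f := cf_coef^~ f) pXS pXT XX fS fT).
apply/is_super_theoryP; split=> // [|X L XX KL].
  split; try by apply: pjoin_set1; rewrite ?superKs1 ?superXs0.
  rewrite -(dim_block_span pX XP) -(dim_block_span pK KP).
  by congr (\dim _).
apply: XtoK KL; rewrite memvE; exact: (sumv_sup X).
Qed.

Definition super_join S T : superTheory := SuperTheory (join_pairP S T).

Fact super_joinP S T U :
  super_le (super_join S T) U = super_le S U && super_le T U.
Proof.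
have pS := superKs_partition S; have pT := superKs_partition T.
apply/idP/andP=> [JU | [SU TU]]; last first.
  by apply: pjoin_refines => //; apply: superKs_partition.
split; first exact: refines_trans (refines_pjoinl _ pS) JU.
by apply: refines_trans JU; rewrite /superKs /= pjoinC; apply: refines_pjoinl.
Qed.

Definition min_pair : {set {set Iirr G}} * {set {set gT}} :=
  ([set [set i] | i in Iirr G], classes G).

Fact min_pairP : is_super_theory min_pair.
Proof.
apply/is_super_theoryP; split.
- apply/and3P; split.
  + apply/eqP/setP=> i; rewrite inE; apply/bigcupP; exists [set i]; last exact: set11.
    exact: imset_f.
  + apply/trivIsetP=> _ _ /imsetP[i _ ->] /imsetP[j _ ->] nij.
    by rewrite disjoints1 inE; apply: contraNneq nij => ->.
  + by apply/imsetP=> -[i _ /setP/(_ i)]; rewrite !inE eqxx.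
- exact: classes_partition.
- by move=> L x g /imsetP[y _ ->] yx; rewrite -(class_eqP yx) memJ_class ?inE.
- split; [exact: classes1 | exact: imset_f |].
  by rewrite card_imset ?card_ord ?NirrE //; apply: set1_inj.
- move=> X L _ /imsetP[z _ ->] _ _ /imsetP[g _ ->] /imsetP[h _ ->].
  by rewrite !cfunJ ?inE.
Qed.

Definition min_theory : superTheory := SuperTheory min_pairP.

Fact min_theory_le S : super_le min_theory S.
Proof.
apply/refinesP=> _ /imsetP[x _ ->].
have /and3P[/eqP covS _ _] := superKs_partition S.
have Sx : x \in cover (superKs S) by rewrite covS.
exists (pblock (superKs S) x); first exact: pblock_mem.
apply/subsetP=> _ /imsetP[g _ ->].
by apply: (superKsJ g (pblock_mem Sx)); rewrite mem_pblock.
Qed.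

Definition super_meet S T : superTheory :=
  foldr super_join min_theory
    [seq U <- enum superTheory | super_le U S & super_le U T].

Fact super_meetP U S T :
  super_le U (super_meet S T) = super_le U S && super_le U T.
Proof.
have foldP s V : super_le (foldr super_join min_theory s) V = all (super_le^~ V) s.
  by elim: s => [|W s IHs] /=; rewrite ?min_theory_le // super_joinP IHs.
pose s := [seq W <- enum superTheory | super_le W S & super_le W T].
have sE V : (V \in s) = super_le V S && super_le V T.
  by rewrite mem_filter mem_enum andbT.
have ms V : V \in s -> super_le V (super_meet S T).
  by have := foldP s (super_meet S T); rewrite super_le_refl => /esym/allP; apply.
apply/idP/idP=> [leU | leU]; last by apply: ms; rewrite sE.
apply/andP; split; apply: super_le_trans leU _; rewrite foldP; apply/allP=> V.
  by rewrite sE => /andP[].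
by rewrite sE => /andP[].
Qed.

End SuperTheory.

Fact super_display : Order.disp_t. Proof. exact: Order.Disp tt tt. Qed.

HB.instance Definition _ (gT : finGroupType) :=
  Order.Le_isPOrder.Build super_display (superTheory gT)
    (@super_le_refl gT) (@super_le_anti gT) (@super_le_trans gT).
HB.instance Definition _ (gT : finGroupType) :=
  Order.POrder_MeetJoin_isLattice.Build super_display (superTheory gT)
    (@super_meetP gT) (@super_joinP gT).
HB.instance Definition _ (gT : finGroupType) :=
  Order.hasBottom.Build super_display (superTheory gT) (@min_theory_le gT).

Section GroupAlgebra.
Variable C : fieldType.

(* The element sum_g a_g g of the group algebra is the function g |-> a_g.    *)
Notation galg gT := {ffun gT -> C^o}.

Definition gconv (gT : finGroupType) (a b : galg gT) : galg gT :=
  [ffun g => \sum_(p : gT * gT | (p.1 * p.2)%g == g) (a p.1 : C) * (b p.2 : C)].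

Definition hadamard (gT : finGroupType) (a b : galg gT) : galg gT :=
  [ffun g => (a g : C) * (b g : C)].

Definition class_sum (gT : finGroupType) (L : {set gT}) : galg gT :=
  [ffun g => (g \in L)%:R].

Definition super_alg (gT : finGroupType) (S : superTheory gT) :
    {vspace galg gT} :=
  (\sum_(L in superKs S) <[class_sum L]>)%VS.

(* A linear map between the algebras of S and T is represented by one of its  *)
(* linear extensions to the full group algebras; only its restriction to the  *)
(* algebra of S matters.                                                      *)
Definition super_hom (gT1 gT2 : finGroupType) (S : superTheory gT1)
    (T : superTheory gT2) (phi : 'Hom(galg gT1, galg gT2)) :=
  [/\ (phi @: super_alg S <= super_alg T)%VS,
      {in super_alg S &, {morph phi : x y / gconv x y}} &
      {in super_alg S &, {morph phi : x y / hadamard x y}}].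

Definition super_isom (gT1 gT2 : finGroupType) (S : superTheory gT1)
    (T : superTheory gT2) :=
  exists phi : 'Hom(galg gT1, galg gT2),
    [/\ super_hom S T phi, {in super_alg S &, injective phi} &
        (phi @: super_alg S)%VS = super_alg T].

End GroupAlgebra.

(* Main.v *)
Require Import Defs.
From HB Require Import structures.
From mathcomp Require Import all_boot all_order all_algebra.
From mathcomp Require Import all_fingroup all_solvable all_field all_character.
From mathcomp Require Import ring.

Set Implicit Arguments.
Unset Strict Implicit.
Unset Printing Implicit Defensive.

Import Order.TTheory GRing.Theory Num.Theory GroupScope.
Local Open Scope ring_scope.

(** Why the theorem holds.  Write G for the semidirect product of H and K, and
compare G with H x K along the identity of their common underlying set.  If
u = (h1, k1) and v = (h2, k2), then the element of G underlying the product uv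
of H x K is u * v', the product taken in G, where v' is a G-conjugate of v:
since K is abelian, v' = v ^ (1, k1) works ([sd_twist]).  For fixed u the map
v |-> v' is a bijection, because v' = u^-1 * (uv).  So when b is constant on
the G-conjugacy classes, the convolution of a and b is the same in both groups
([gconv_pullback]).  The Hadamard product and the all-one vector ignore the
group law, hence a partition of G into unions of G-classes has a class-sum
algebra for G if and only if it has one for H x K; as H x K is abelian, its own
conjugacy classes impose no condition.  Transport of the partition is thus an
isomorphism of the lattice of supercharacter theories of G onto those of H x K
above the transported minimal theory, and each transported theory has the same
algebra as the original one.

The remaining point is that a supercharacter theory is determined by its
partition of the group, and that the partitions which occur are those whose
class functions are closed under convolution ([schur_superKs],
[super_of_schurP]).  The second half is where characters enter.  The maps
f |-> #|G| * cf_coef i f are the multiplicative characters of the algebra of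
class functions under convolution.  Grouping the indices i that agree on the
given subalgebra yields the partition of Irr(G), and a product of
Lagrange-type factors inside the subalgebra produces, up to a scalar, each
superchar X, that is, a multiple of the central idempotent of its block. *)

(** * Convolution of class functions and irreducible characters *)

Definition block_const (I : finType) (T : Type) (P : {set {set I}})
    (a : I -> T) :=
  forall B, B \in P -> {in B &, forall x y, a x = a y}.

Section Schur.
Variable gT : finGroupType.
Local Notation G := [set: gT].
Implicit Types (f g : 'CF(G)) (Ks : {set {set gT}}).

(** The partitions into unions of conjugacy classes that underlie central Schur
rings. Closure is stated over algC, where the irreducible characters live. *)
Definition schur_partition Ks :=
  [/\ partition Ks G, [set 1%g] \in Ks,
      forall L x y, L \in Ks -> x \in L -> (x ^ y)%g \in L &
      forall a b : {ffun gT -> algC^o},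
        block_const Ks a -> block_const Ks b -> block_const Ks (gconv a b)].

(** Convolution, defined on the side of the characters so that it is visibly a
class function; [cfconvE] identifies it with the product of the group algebra. *)
Definition cfconv f g : 'CF(G) :=
  \sum_i (#|G|%:R * (cf_coef i f * cf_coef i g)) *: ('chi_i 1%g *: 'chi_i).

Let nzG : #|G|%:R != 0 :> algC.
Proof. by rewrite pnatr_eq0 -lt0n cardG_gt0. Qed.

Lemma cf_coefE f x : f x = \sum_i cf_coef i f * 'chi_i 1%g * 'chi_i x.
Proof.
rewrite {1}[f]cfun_sum_cfdot sum_cfunE; apply: eq_bigr => i _.
by rewrite cfunE /cf_coef divfK ?irr1_neq0.
Qed.

(** The scaled coefficient at i is the central character of the dual of 'chi_i, so
it is multiplicative for convolution. *)
Lemma cfconv_coef i f g :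
  #|G|%:R * cf_coef i (cfconv f g)
    = (#|G|%:R * cf_coef i f) * (#|G|%:R * cf_coef i g).
Proof.
suff -> : cf_coef i (cfconv f g) = #|G|%:R * (cf_coef i f * cf_coef i g).
  by ring.
have coef_chi j : cf_coef i ('chi_j 1%g *: 'chi_j) = (i == j)%:R.
  rewrite linearZ /= /cf_coef cfdot_irr eq_sym.
  by case: eqP => [->|_]; rewrite ?mul0r ?scaler0 // mul1r [LHS]divff ?irr1_neq0.
rewrite /cfconv linear_sum (bigD1 i) //= big1 ?addr0 => [|j nji].
  by rewrite linearZ /= coef_chi eqxx [LHS]mulr1.
by rewrite linearZ /= coef_chi eq_sym (negPf nji) scaler0.
Qed.

Lemma irr_conv (i j : Iirr G) x :
  \sum_y 'chi_i (x * y^-1)%g * 'chi_j y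
    = (i == j)%:R * (#|G|%:R * ('chi_i x / 'chi_i 1%g)).
Proof.
have := generalized_orthogonality_relation (G := [set: gT]) x i j.
move=> /(canRL (mulVKf nzG)); rewrite mulrCA => <-.
rewrite (reindex_inj invg_inj) /=; apply: eq_big => [y | y _].
  by rewrite inE.
rewrite invgK -(cfunJ 'chi_i (y * x)%g (in_setT y)).
by rewrite conjgE !mulgA mulVg mul1g.
Qed.

(** Expand f and g in irreducible characters; the generalised orthogonality
relations [irr_conv] leave only the diagonal terms. *)
Lemma cfconvE f g x :
  cfconv f g x = \sum_(p : gT * gT | (p.1 * p.2)%g == x) f p.1 * g p.2.
Proof.
rewrite (reindex_onto (fun y => (x * y^-1, y)%g) snd) /=; last first.
  by case=> u v /= /eqP <-; rewrite mulgK.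
transitivity (\sum_y \sum_i \sum_j
    (cf_coef i f * 'chi_i 1%g) * (cf_coef j g * 'chi_j 1%g) *
      ('chi_i (x * y^-1)%g * 'chi_j y)); last first.
  apply: eq_big => [y | y _]; first by rewrite mulgKV !eqxx.
  rewrite [f _]cf_coefE [g _]cf_coefE big_distrl /=; apply: eq_bigr => i _.
  by rewrite big_distrr /=; apply: eq_bigr => j _; rewrite mulrACA.
rewrite exchange_big sum_cfunE; apply: eq_bigr => i _ /=.
rewrite exchange_big (bigD1 i) //= [X in _ + X]big1 ?addr0 => [|j nji].
  rewrite -big_distrr /= irr_conv eqxx mul1r !cfunE.
  by have nz1 := irr1_neq0 i; field.
by rewrite -big_distrr /= irr_conv eq_sym (negPf nji) mul0r mulr0.
Qed.

Lemma cf_coef_unit i : #|G|%:R * cf_coef i ('1_[set 1%g] : 'CF(G)) = 1.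
Proof.
have J1 (y u : gT) : y \in [set 1%g] -> (y ^ u)%g \in [set 1%g].
  by move/set1P->; rewrite conj1g set11.
have at1 x : ('1_[set 1%g] : 'CF(G)) x = (x == 1%g)%:R.
  by have := cf_at_cfuni x J1; rewrite inE.
rewrite /cf_coef cfdotE (bigD1 1%g) ?inE //= big1 => [|x /andP[_ nx1]].
  rewrite addr0 at1 eqxx mul1r -mulrA mulVKf // (CrealP _) ?divff ?irr1_neq0 //.
  by rewrite irr1_degree realn.
by rewrite at1 (negPf nx1) mul0r.
Qed.


(** * Supercharacter theories as Schur partitions *)

Lemma cfun_of_invariant (a : gT -> algC) :
  (forall x y, a (x ^ y)%g = a x) -> {f : 'CF(G) | forall x, f x = a x}.
Proof.
move=> aJ; have af : is_class_fun <<G>>%g [ffun x => a x].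
  by apply: intro_class_fun => [x y _ _ | x /negP[]]; rewrite ?aJ // mem_gen ?inE.
by exists (Cfun 0 af) => x; rewrite cfunElock.
Qed.

Lemma gconv_cfconv f g (a b : {ffun gT -> algC^o}) :
  (forall x, f x = a x) -> (forall x, g x = b x) ->
  forall x, cfconv f g x = gconv a b x.
Proof.
by move=> fE gE x; rewrite cfconvE ffunE; apply: eq_bigr => p _; rewrite fE gE.
Qed.

Lemma block_const_invariant (T : Type) Ks (a : gT -> T) :
  partition Ks G -> (forall L x y, L \in Ks -> x \in L -> (x ^ y)%g \in L) ->
  block_const Ks a -> forall x y, a (x ^ y)%g = a x.
Proof.
case/and3P=> /eqP cov _ _ cK ac x y.
have Kx : x \in cover Ks by rewrite cov inE.
have xP : x \in pblock Ks x by rewrite mem_pblock.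
by apply: (ac _ (pblock_mem Kx)) => //; apply: cK (pblock_mem Kx) xP.
Qed.

(** By duality, the functions constant on the parts in G are those whose
coefficients are constant on the parts in Irr(G); convolution multiplies
coefficients, so it preserves the latter condition. *)
Lemma schur_superKs (S : superTheory gT) : schur_partition (superKs S).
Proof.
have pK := superKs_partition S; have cK L x y := @superKsJ _ S L x y.
split=> // [|a b ac bc]; first exact: superKs1.
have [f fE] := cfun_of_invariant (block_const_invariant pK cK ac).
have [g gE] := cfun_of_invariant (block_const_invariant pK cK bc).
have Kf : f \in Kspace (superKs S).
  by apply/KspaceP=> L KL x y Lx Ly; rewrite !fE; apply: ac Lx Ly.
have Kg : g \in Kspace (superKs S).
  by apply/KspaceP=> L KL x y Lx Ly; rewrite !gE; apply: bc Lx Ly.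
suff /KspaceP Kfg : cfconv f g \in Kspace (superKs S).
  by move=> L KL x y Lx Ly; rewrite -!(gconv_cfconv fE gE) (Kfg L KL x y).
move: Kf Kg; rewrite -XspaceE => /XspaceP Xf /XspaceP Xg.
apply/XspaceP=> X XX i j Xi Xj; apply: (mulfI nzG).
by rewrite !cfconv_coef (Xf X XX i j Xi Xj) (Xg X XX i j Xi Xj).
Qed.

Section SuperOfSchur.
Variable Ks : {set {set gT}}.
Hypothesis schurK : schur_partition Ks.

(** Two irreducible characters are equivalent when the corresponding central
characters agree on the span of the class sums of Ks. *)
Definition dual_partition : {set {set Iirr G}} :=
  preim_partition (fun i => [seq cf_coef i '1_L | L <- enum Ks]) [set: Iirr G].

Let pK : partition Ks G. Proof. by case: schurK. Qed.
Let cK L x y : L \in Ks -> x \in L -> (x ^ y)%g \in L.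
Proof. by case: schurK => _ _ cK _; apply: cK. Qed.
Let pX : partition dual_partition [set: Iirr G].
Proof. exact: preim_partitionP. Qed.

Let at_cfuni L x : L \in Ks -> cf_at x '1_L = (x \in L)%:R.
Proof. by move=> KL; apply: cf_at_cfuni => y g; apply: cK. Qed.

Lemma Kspace_constP f : reflect (block_const Ks f) (f \in Kspace Ks).
Proof.
rewrite /block_const; apply: (block_spanP (@cf_at_inj gT) pK) => L x.
exact: at_cfuni.
Qed.

Lemma cfconv_Kspace f g :
  f \in Kspace Ks -> g \in Kspace Ks -> cfconv f g \in Kspace Ks.
Proof.
move=> /Kspace_constP fc /Kspace_constP gc; apply/Kspace_constP.
pose a := [ffun x => f x : algC^o]; pose b := [ffun x => g x : algC^o].
have fE x : f x = a x by rewrite ffunE.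
have gE x : g x = b x by rewrite ffunE.
have [_ _ _ conv] := schurK; move=> L KL x y Lx Ly.
rewrite !(gconv_cfconv fE gE); apply: (conv a b) Lx Ly => // M KM u v Mu Mv.
  by rewrite -!fE; apply: fc Mu Mv.
by rewrite -!gE; apply: gc Mu Mv.
Qed.

Lemma unit_Kspace : '1_[set 1%g] \in Kspace Ks.
Proof.
rewrite memvE; apply: (sumv_sup [set 1%g]) => //.
by case: schurK.
Qed.

Lemma dual_blockP X i j : X \in dual_partition -> i \in X ->
  reflect (forall L, L \in Ks -> cf_coef i '1_L = cf_coef j '1_L) (j \in X).
Proof.
move=> XX Xi; have /and3P[_ trX _] := pX.
rewrite -(def_pblock trX XX Xi) pblock_equivalence_partition ?inE //; last first.
  by split=> // /eqP->.
apply: (iffP eqP) => [/eq_in_map eqij L KL | eqij].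
  by apply: eqij; rewrite mem_enum.
by apply/eq_in_map=> L; rewrite mem_enum; apply: eqij.
Qed.

Lemma Xspace_constP f :
  reflect (block_const dual_partition (fun i => cf_coef i f))
          (f \in Xspace dual_partition).
Proof.
rewrite /block_const; apply: (block_spanP (@cf_coef_inj gT) pX) => X i _.
exact: cf_coef_superchar.
Qed.

Lemma sub_Kspace_Xspace : (Kspace Ks <= Xspace dual_partition)%VS.
Proof.
apply/subv_sumP=> L KL; rewrite -memvE; apply/Xspace_constP=> X XX i j Xi Xj.
exact: (dual_blockP j XX Xi Xj).
Qed.

Lemma Kspace_coef f :
  f \in Kspace Ks -> block_const dual_partition (fun i => cf_coef i f).
Proof. by move/(subvP sub_Kspace_Xspace)/Xspace_constP. Qed.

(** The finite Stone-Weierstrass argument: an algebra of functions on Irr(G) that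
contains 1 contains the indicator of every class of points that it does not
separate. *)
Lemma superchar_Kspace X : X \in dual_partition -> superchar X \in Kspace Ks.
Proof.
move=> XX; have [i Xi] : exists i, i \in X.
  have /and3P[_ _ nX0] := pX.
  by apply/set0Pn; apply: contraNneq nX0 => <-.
pose w (j : Iirr G) f : algC := #|G|%:R * cf_coef j f.
have wZ j a f : w j (a *: f) = a * w j f.
  by rewrite /w linearZ /= [LHS]mulrCA.
have wB j f g : w j (f - g) = w j f - w j g.
  by rewrite /w linearB /= [LHS]mulrBr.
have wD j a f : w j (f - a *: '1_[set 1%g]) = w j f - a.
  by rewrite wB wZ /w cf_coef_unit mulr1.
(* For j outside the block, some f in the algebra tells j from i; for j inside
   any element of the algebra will do. *)
have sep j : exists2 f, f \in Kspace Ks & (j \notin X) ==> (w i f != w j f).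
  have [Xj | nXj] := boolP (j \in X).
    by exists '1_[set 1%g]; rewrite ?unit_Kspace ?Xj.
  have /exists_inP[L KL nLij] :
      [exists L in Ks, cf_coef i '1_L != cf_coef j '1_L].
    apply: contraNT nXj; rewrite negb_exists_in => /forall_inP eqij.
    by apply/(dual_blockP j XX Xi) => L /eqij/negPn/eqP.
  exists '1_L; last by rewrite /w (inj_eq (mulfI nzG)).
  by rewrite memvE; apply: (sumv_sup L).
pose s j : 'CF(G) := s2val (sig2W (sep j)).
have Ks_s j : s j \in Kspace Ks by rewrite /s; case: sig2W.
have nes j : j \notin X -> w i (s j) != w j (s j).
  by apply/implyP; rewrite /s; case: sig2W.
(* The factor t j takes the value 1 at i and 0 at j, so that the product e over
   all j outside X takes the value 1 on X and 0 elsewhere. *)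
pose t j := (w i (s j) - w j (s j))^-1 *: (s j - w j (s j) *: '1_[set 1%g]).
pose e := \big[cfconv/'1_[set 1%g]]_(j | j \notin X) t j.
have Ke : e \in Kspace Ks.
  rewrite /e; apply: (big_ind (fun f => f \in Kspace Ks)).
  - exact: unit_Kspace.
  - exact: cfconv_Kspace.
  by move=> j _; rewrite memvZ // memvB // memvZ // unit_Kspace.
have we k : w k e = \prod_(j | j \notin X) w k (t j).
  rewrite /e; apply: (big_morph (w k)) => [f g|]; first exact: cfconv_coef.
  exact: cf_coef_unit.
have wei : w i e = 1.
  rewrite we big1 // => j nXj.
  by rewrite wZ wD mulVf // subr_eq0 nes.
have -> : superchar X = #|G|%:R *: e.
  apply/eqP; rewrite -subr_eq0; apply/eqP/cf_coef_inj => k.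
  apply: (mulfI nzG); rewrite mulr0 -/(w k _) wB wZ /w cf_coef_superchar.
  rewrite -mulrBr -/(w k e); have [Xk | nXk] := boolP (k \in X).
    by rewrite /w (Kspace_coef Ke XX Xk Xi) -/(w i e) wei subrr mulr0.
  by rewrite we (bigD1 k) //= wZ wD subrr mulr0 mul0r subrr mulr0.
exact: memvZ.
Qed.

(** The constant function 1 is superchar [set 0], and it lies in the algebra; its
coefficients therefore separate 0 from every other index. *)
Lemma dual_partition0 : [set 0] \in dual_partition.
Proof.
have /and3P[/eqP covX _ _] := pX.
have X0 : 0 \in cover dual_partition by rewrite covX inE.
suff <- : pblock dual_partition 0 = [set 0] by apply: pblock_mem.
apply/eqP; rewrite eqEsubset sub1set mem_pblock X0 andbT.
apply/subsetP=> j Xj.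
have K1 : superchar [set 0] \in Kspace Ks.
  apply/Kspace_constP=> L KL x y _ _.
  by rewrite /superchar big_set1 irr0 !cfunE !cfun1E !inE.
have X00 : 0 \in pblock dual_partition 0 by rewrite mem_pblock.
have := Kspace_coef K1 (pblock_mem X0) X00 Xj; rewrite !cf_coef_superchar.
rewrite set11 => /eqP; rewrite eqr_nat.
by case: (j \in _).
Qed.

(** The equality of the numbers of parts is the equality of the dimensions of the
two spaces that they span. *)
Lemma super_of_schurP : is_super_theory (dual_partition, Ks).
Proof.
have K1 : [set 1%g] \in Ks by case: schurK.
apply/is_super_theoryP; split=> // [|X L XX KL].
  split=> //; first exact: dual_partition0.
  rewrite -(dim_block_span pX (fun X i _ => cf_coef_superchar X i)).
  rewrite -(dim_block_span pK (fun L x => @at_cfuni L x)).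
  congr (\dim _); apply/eqP; rewrite eqEsubv sub_Kspace_Xspace andbT.
  by apply/subv_sumP=> X XX; rewrite -memvE; apply: superchar_Kspace.
by have /Kspace_constP := superchar_Kspace XX; apply.
Qed.

Definition super_of_schur : superTheory gT := SuperTheory super_of_schurP.

End SuperOfSchur.

Lemma superKs_inj : injective (@superKs gT).
Proof.
by move=> S T eqK; apply: super_le_anti; rewrite /super_le eqK refines_refl.
Qed.

End Schur.

(** * Transport of blocks along a bijection *)

Definition push_blocks (I J : finType) (e : I -> J) (P : {set {set I}}) :=
  [set e @: B | B : {set I} in P].

Section PushBlocks.
Variables (I J : finType) (e : I -> J) (e' : J -> I).
Hypotheses (eK : cancel e e') (e'K : cancel e' e).
Implicit Types P Q : {set {set I}}.

Let e_inj : injective e := can_inj eK.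

Lemma push_blocks_partition P :
  partition P [set: I] -> partition (push_blocks e P) [set: J].
Proof.
suff -> : [set: J] = e @: [set: I] by rewrite imset_partition.
by apply/setP=> y; rewrite inE -(e'K y) imset_f.
Qed.

Lemma push_blocksK P : push_blocks e' (push_blocks e P) = P.
Proof.
have imK (B : {set I}) : e' @: (e @: B) = B.
  by rewrite -imset_comp (eq_imset _ eK) imset_id.
by rewrite /push_blocks -imset_comp (eq_imset _ imK) imset_id.
Qed.

Lemma refines_push_blocks P Q :
  refines (push_blocks e P) (push_blocks e Q) = refines P Q.
Proof.
apply/refinesP/refinesP => PQ B.
  move=> PB; have [_ /imsetP[D QD ->] sBD] := PQ _ (imset_f _ PB).
  exists D => //; apply/subsetP=> x Bx.
  by rewrite -(mem_imset _ _ e_inj); apply: (subsetP sBD); apply: imset_f.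
case/imsetP=> {}B /PQ[D QD sBD] ->; exists (e @: D); first exact: imset_f.
exact: imsetS.
Qed.

Lemma block_const_push (T : Type) P (a : J -> T) :
  block_const (push_blocks e P) a <-> block_const P (a \o e).
Proof.
split=> ac B => [PB x y Bx By | /imsetP[{}B PB ->]].
  by apply: (ac (e @: B)); rewrite imset_f.
by move=> _ _ /imsetP[x Bx ->] /imsetP[y By ->]; apply: (ac B).
Qed.

End PushBlocks.

(** * Transport of theories along a bijection that twists products *)

Section Pullback.
Variables (C : fieldType) (gT1 gT2 : finGroupType) (e' : gT2 -> gT1).

Definition pullback (a : {ffun gT1 -> C^o}) : {ffun gT2 -> C^o} :=
  [ffun v => a (e' v)].

Fact pullback_linear : linear pullback.
Proof. by move=> k a b; apply/ffunP=> v; rewrite !ffunE. Qed.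
HB.instance Definition _ := GRing.isLinear.Build C
  {ffun gT1 -> C^o} {ffun gT2 -> C^o} *:%R pullback pullback_linear.

End Pullback.

Lemma super_alg_invariant (C : fieldType) (gT : finGroupType)
    (S : superTheory gT) (a : {ffun gT -> C^o}) :
  a \in super_alg C S -> forall x y, a (x ^ y)%g = a x.
Proof.
case/memv_sumP=> u u_line -> x y; rewrite !sum_ffunE; apply: eq_bigr => L KL.
have LJ : ((x ^ y)%g \in L) = (x \in L).
  apply/idP/idP=> [|Lx]; last exact: superKsJ KL Lx.
  by move/(superKsJ y^-1%g KL); rewrite conjgK.
by have /vlineP[k ->] := u_line L KL; rewrite !ffunE LJ.
Qed.

Section Transport.
Variables (gT1 gT2 : finGroupType) (e : gT1 -> gT2) (e' : gT2 -> gT1).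
Hypotheses (eK : cancel e e') (e'K : cancel e' e).
Hypothesis abG2 : abelian [set: gT2].
(* The product of gT2, read in gT1, is the product of gT1 with its right factor
   replaced by a conjugate. *)
Hypothesis twist :
  forall u v, ((e' u)^-1 * e' (u * v))%g \in e' v ^: [set: gT1].

Lemma twist1 : e' 1%g = 1%g.
Proof.
have /imsetP[x _ /eqP] := twist 1%g 1%g.
by rewrite mulg1 mulVg eq_sym conjg_eq1 => /eqP.
Qed.

(** The substitution (u, v) |-> (u, u^-1 * (u v)), where u v is the product of gT2,
is a bijection from the factorisations of w in gT2 to those in gT1; it replaces
the right factor by a conjugate, which b does not notice. *)
Lemma gconv_pullback (C : fieldType) (a b : {ffun gT1 -> C^o}) :
  (forall x y, b (x ^ y)%g = b x) ->
  gconv (pullback e' a) (pullback e' b) = pullback e' (gconv a b).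
Proof.
move=> bJ; apply/ffunP=> w; rewrite !ffunE.
pose h (p : gT2 * gT2) := (e' p.1, (e' p.1)^-1 * e' (p.1 * p.2))%g.
pose h' (q : gT1 * gT1) := (e q.1, (e q.1)^-1 * e (q.1 * q.2))%g.
have h_bij : bijective h.
  exists h' => [[u v] | [x y]]; rewrite /h /h' /=.
    by rewrite e'K mulKVg e'K mulKg.
  by rewrite eK mulKVg eK mulKg.
rewrite [RHS](reindex h) /=; last exact: onW_bij.
apply: eq_big => [[u v] | [u v] _] /=.
  by rewrite mulKVg (can_eq e'K).
rewrite !ffunE; congr (_ * _).
by have /imsetP[y _ ->] := twist u v.
Qed.

Lemma schur_push Ks :
  schur_partition Ks -> schur_partition (push_blocks e Ks).
Proof.
case=> pK K1 cK conv; split.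
- exact (push_blocks_partition eK e'K pK).
- apply/imsetP; exists [set 1%g] => //.
  by rewrite imset_set1 -twist1 e'K.
- move=> L x y _ Lx; rewrite conjgE.
  by rewrite (centsP abG2 x (in_setT _) y (in_setT _)) mulKg.
move=> a b /block_const_push ac /block_const_push bc; apply/block_const_push.
have lift (c : {ffun gT2 -> algC^o}) : c = pullback e' [ffun x => c (e x)].
  by apply/ffunP=> v; rewrite !ffunE e'K.
have const (c : {ffun gT2 -> algC^o}) : block_const Ks (c \o e) ->
    block_const Ks ([ffun x => c (e x)] : {ffun gT1 -> algC^o}).
  by move=> cc L KL x y Lx Ly; rewrite !ffunE; apply: (cc L).
rewrite (lift a) (lift b) gconv_pullback; last first.
  exact: block_const_invariant pK cK (const b bc).
move=> L KL x y Lx Ly; rewrite /= [LHS]ffunE [RHS]ffunE !eK.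
by apply: (conv _ _ (const a ac) (const b bc) L).
Qed.

(** Coarsening the images of the conjugacy classes is exactly what makes the parts
invariant under conjugation in gT1, and hence [gconv_pullback] applicable. *)
Lemma schur_pull Ks :
  schur_partition Ks -> refines (push_blocks e (classes [set: gT1])) Ks ->
  schur_partition (push_blocks e' Ks).
Proof.
case=> pK K1 _ conv clK; have /and3P[_ trK _] := pK.
have pK' := push_blocks_partition e'K eK pK.
have cK L x y : L \in push_blocks e' Ks -> x \in L -> (x ^ y)%g \in L.
  case/imsetP=> M KM -> /imsetP[m Mm ->].
  have clx : e @: (e' m ^: [set: gT1]) \in push_blocks e (classes [set: gT1]).
    by apply/imset_f/mem_classes; rewrite inE.
  have [M' KM' sM'] := refinesP _ _ clK _ clx.
  have inM' z : e (e' m ^ z)%g \in M'.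
    by apply: (subsetP sM'); rewrite imset_f // memJ_class ?inE.
  have M'm : m \in M' by have := inM' 1%g; rewrite conjg1 e'K.
  rewrite -(def_pblock trK KM Mm) (def_pblock trK KM' M'm).
  by apply/imsetP; exists (e (e' m ^ y)%g); rewrite ?eK.
split=> //.
- by apply/imsetP; exists [set 1%g]; rewrite // imset_set1 twist1.
move=> a b ac bc; have bJ := block_const_invariant pK' cK bc.
have const (c : {ffun gT1 -> algC^o}) :
    block_const (push_blocks e' Ks) c -> block_const Ks (pullback e' c).
  move/block_const_push=> cc L KL x y Lx Ly; rewrite !ffunE.
  exact: (cc L KL x y Lx Ly).
apply/block_const_push => L KL x y Lx Ly.
have := conv _ _ (const a ac) (const b bc) L KL x y Lx Ly.
by rewrite gconv_pullback // [LHS]ffunE [RHS]ffunE.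
Qed.

Definition push_theory (S : superTheory gT1) : superTheory gT2 :=
  super_of_schur (schur_push (schur_superKs S)).

Lemma push_theory_le S T : (push_theory S <= push_theory T)%O = (S <= T)%O.
Proof. exact: refines_push_blocks eK _ _. Qed.

Lemma push_theory_onto T :
  (push_theory (min_theory gT1) <= T)%O -> exists S, push_theory S = T.
Proof.
move=> leT; exists (super_of_schur (schur_pull (schur_superKs T) leT)).
by apply: superKs_inj; apply: push_blocksK.
Qed.

Lemma push_theory_isom (C : fieldType) S : super_isom C S (push_theory S).
Proof.
pose phi := linfun (pullback (C := C) e').
have phiE a : phi a = pullback e' a by rewrite lfunE.
have phi_alg : (phi @: super_alg C S)%VS = super_alg C (push_theory S).
  rewrite limg_sum /super_alg big_imset /= => [|L M _ _]; last first.
    exact: (imset_inj (can_inj eK)).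
  apply: eq_bigr => L _; rewrite limg_line phiE; congr <[_]>%VS.
  by apply/ffunP=> v; rewrite !ffunE -{2}(e'K v) mem_imset //; apply: can_inj eK.
exists phi; split=> //.
  split; first by rewrite phi_alg.
    move=> a b _ Sb; rewrite !phiE gconv_pullback //.
    exact: super_alg_invariant Sb.
  by move=> a b _ _; rewrite !phiE; apply/ffunP=> v; rewrite !ffunE.
move=> a b _ _; rewrite !phiE => /ffunP eqab; apply/ffunP=> x.
by have := eqab (e x); rewrite !ffunE eK.
Qed.

End Transport.

(** * Order embeddings onto an upper set *)

Section UpsetEmbedding.
Variables (d1 d2 : Order.disp_t) (L1 : latticeType d1) (L2 : latticeType d2).
Variables (F : L1 -> L2) (a : L2).
Hypotheses (F_le : forall x y, (F x <= F y)%O = (x <= y)%O)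
  (F_ge : forall x, (a <= F x)%O)
  (F_onto : forall y, (a <= y)%O -> exists x, F x = y).

(** The meet of two values is still above a, hence is itself a value of F. *)
Lemma upset_embedding_meet : {morph F : x y / Order.meet x y}.
Proof.
move=> x y; apply/le_anti; rewrite lexI !F_le leIl leIr /=.
have [z zE] : exists z, F z = Order.meet (F x) (F y).
  by apply: F_onto; rewrite lexI !F_ge.
by rewrite -zE F_le lexI -!F_le zE leIl leIr.
Qed.

Lemma upset_embedding_join : {morph F : x y / Order.join x y}.
Proof.
move=> x y; apply/le_anti; rewrite leUx !F_le leUl leUr !andbT.
have [z zE] : exists z, F z = Order.join (F x) (F y).
  by apply: F_onto; rewrite lexU2 ?F_ge.
by rewrite -zE F_le leUx -!F_le zE leUl leUr.
Qed.

Lemma upset_embedding_bij :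
  bijective (fun x => exist (fun y => (a <= y)%O) (F x) (F_ge x)).
Proof.
have onto (y : {y : L2 | (a <= y)%O}) : exists x, F x == sval y.
  by have [x <-] := F_onto (svalP y); exists x.
pose G y := xchoose (onto y).
have FG y : F (G y) = sval y by apply/eqP/(xchooseP (onto y)).
exists G => [x | y]; last by apply: val_inj; apply: FG.
by apply/le_anti; rewrite -!F_le FG lexx.
Qed.

End UpsetEmbedding.

(** * The semidirect product against the direct product *)

Lemma sd_pairK (hT kT : finGroupType) (psi : autHom hT kT) :
  cancel (@sd_pair hT kT psi) (@SemiDirect hT kT psi).
Proof. by case. Qed.

(** Conjugating (h2, k2) by (1, k1) gives (psi k1^-1 h2, k2), since K is abelian;
multiplying by (h1, k1) on the left then undoes the twist. *)
Lemma sd_twist (hT kT : finGroupType) (abK : abelian [set: kT])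
    (psi : autHom hT kT) (u v : hT * kT) :
  ((SemiDirect psi u)^-1 * SemiDirect psi (u * v))%g
    \in SemiDirect psi v ^: [set: semidirect psi].
Proof.
case: u v => [h1 k1] [h2 k2].
apply/imsetP; exists (SemiDirect psi (1%g, k1)); first by rewrite inE.
apply: (canLR (mulKg _)); rewrite conjgE !mulgA.
have mulE (x y : hT) (k l : kT) :
  (SemiDirect psi (x, k) * SemiDirect psi (y, l))%g
    = SemiDirect psi ((x * psi k y)%g, (k * l)%g) by [].
have invE (x : hT) (k : kT) : ((SemiDirect psi (x, k))^-1)%g
    = SemiDirect psi (psi k^-1%g x^-1%g, k^-1%g) by [].
have psi1 k : psi k 1%g = 1%g.
  by apply: (mulgI (psi k 1%g)); rewrite -autHomJ !mulg1.
rewrite invE !mulE invg1 !psi1 !mulg1 mulgV autHom1; congr (SemiDirect _ (_, _)).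
by rewrite mul1g (centsP abK k1 (in_setT _) k2 (in_setT _)).
Qed.

Lemma abelian_pair (hT kT : finGroupType) :
  abelian [set: hT] -> abelian [set: kT] -> abelian [set: hT * kT].
Proof.
move=> abH abK; apply/centsP=> [[h1 k1] _ [h2 k2] _].
by congr (_, _); [apply: (centsP abH) | apply: (centsP abK)]; rewrite inE.
Qed.

Theorem mainTheorem2 (C : numClosedFieldType) (hT kT : finGroupType)
    (abH : abelian [set: hT]) (abK : abelian [set: kT])
    (psi : autHom hT kT) :
  (forall S : superTheory (semidirect psi),
     exists T : superTheory (hT * kT)%type, super_isom C S T) /\
  (exists A : superTheory (hT * kT)%type,
     super_isom C (min_theory (semidirect psi)) A /\
     exists F : superTheory (semidirect psi) ->
                {T : superTheory (hT * kT)%type | (A <= T)%O},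
       [/\ bijective F,
           {morph (fun S => sval (F S)) : S T / Order.meet S T} &
           {morph (fun S => sval (F S)) : S T / Order.join S T}]).
Proof.
have eK := @sd_pairK hT kT psi.
have e'K : cancel (@SemiDirect hT kT psi) (@sd_pair hT kT psi) by [].
have abG := abelian_pair abH abK; have twist := sd_twist abK psi.
pose push := push_theory eK e'K abG twist.
have isom S : super_isom C S (push S) by apply: push_theory_isom.
split=> [S | ]; first by exists (push S).
have push_le S T : (push S <= push T)%O = (S <= T)%O.
  exact: push_theory_le.
have push_ge S : (push (min_theory _) <= push S)%O.
  by rewrite push_le; apply: min_theory_le.
have onto T : (push (min_theory _) <= T)%O -> exists S, push S = T.
  exact: push_theory_onto.
exists (push (min_theory _)); split; first exact: isom.
exists (fun S => exist _ (push S) (push_ge S)); split.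
- exact: upset_embedding_bij.
- exact: upset_embedding_meet push_ge onto.
- exact: upset_embedding_join push_ge onto.
Qed.
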